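(* Let $a$ and $b$ be non-negative integers. Then $S_2(a,b)=\binom{a+b+1}{a+1}-1$.
   Context: For a positive integer $n$, write $[n]=\{1,\dots,n\}$. A skew Bollob\'{a}s system is a finite collection $\mathcal{P}=\{(A_i,B_i):1\leq i\leq m\}$ of pairs of subsets of $[n]$ (for some positive integer $n$) such that $A_i\cap B_i=\emptyset$ for all $i\in[m]$ and $A_i\cap B_j\neq\emptyset$ for all $1\leq i<j\leq m$. Define $S_2(a,b)$ to be the maximum of $\left|\bigcup_{i=1}^m B_i\right|$ over all skew Bollob\'{a}s systems $\{(A_i,B_i):1\leq i\leq m\}$ (over all $n$ and $m$) satisfying $|A_i|\leq a$ and $|B_i|\leq b$ for all $i\in[m]$. *)

(* Defs.v *)
From mathcomp Require Import all_boot.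

Set Implicit Arguments.
Unset Strict Implicit.
Unset Printing Implicit Defensive.

(* The ground set [n] = {1, ..., n} is encoded as 'I_n, and the index set of
   the system as 'I_m.  The order of the indices matters.  Two pairs with
   different indices are automatically different, so a family indexed by 'I_m
   is the same as a collection of m pairs listed in this order. *)
Definition skew_bollobas (n m : nat) (A B : 'I_m -> {set 'I_n}) : Prop :=
  (forall i : 'I_m, A i :&: B i = set0) /\
  (forall i j : 'I_m, i < j -> A i :&: B j <> set0).

Definition S2_attained (a b s : nat) : Prop :=
  exists (n m : nat) (A B : 'I_m -> {set 'I_n}),
    [/\ 0 < n,
        skew_bollobas A B,
        forall i : 'I_m, #|A i| <= a,
        forall i : 'I_m, #|B i| <= b
      & #|\bigcup_(i < m) B i| = s].

(* S_2(a, b) = s.  The maximum ranges over all n and m, so its existence is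
   not clear beforehand; it is given by a relation, which says that s is
   attained and that no larger value is. *)
Definition is_S2 (a b s : nat) : Prop :=
  S2_attained a b s /\ (forall t : nat, S2_attained a b t -> t <= s).

(* Main.v *)
Require Import Defs.
From mathcomp Require Import all_boot all_algebra zify.

(* Upper bound. Take a minimal subfamily K of the system whose sets B_i still
   cover the union; each of its B_i has a private element p_i, lying in no other
   B_j with j in K. Removing the p_i from the union costs |K|, lowers b by one,
   and the process is repeated on the remainders, the removed elements staying
   private to their index. At the stage where the remainders have size at most
   c, contracting the removed elements of each B_i to one point gives a skew
   system again, now with |B_i| at most c + 1, hence with at most
   'C(a + c + 1, a) pairs by the skew Bollobas theorem. Summing over c < b gives
   'C(a + b + 1, a + 1) - 1.

   Lower bound. From extremal systems for (a, b + 1) and (a + 1, b) on disjoint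
   ground sets, add one new point to every A of the first and every B of the
   second, and list the first system before the second. *)

Set Implicit Arguments.
Unset Strict Implicit.
Unset Printing Implicit Defensive.

Lemma leq_card_bigcup (I T : finType) (K : {set I}) (S : I -> {set T}) :
  #|\bigcup_(i in K) S i| <= \sum_(i in K) #|S i|.
Proof.
elim/big_rec2: _ => [|i n U _ le_Un]; first by rewrite cards0.
by apply: leq_trans (leq_card_setU _ _) _; rewrite leq_add2l.
Qed.

(** Relative to an index set [K] and over any finite type: the upper bound passes to subfamilies in
    their inherited order, while contraction and gluing change the ground set. *)
Definition skew_on (T : finType) m (K : {set 'I_m}) (A B : 'I_m -> {set T}) :=
  (forall i, i \in K -> [disjoint A i & B i]) /\
  (forall i j, i \in K -> j \in K -> i < j -> ~~ [disjoint A i & B j]).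

(** * The skew Bollobás theorem, by a rank argument *)

Section SkewBollobas.

Import GRing.Theory Num.Theory.
Local Open Scope ring_scope.

(** If a nonzero [u] satisfies [u *m M = 0], take [j] in its support with [r j] maximal: entry [j]
    of the product is [u 0 j * M j j], which is nonzero. *)
Lemma triangular_row_free (F : fieldType) k (r : 'I_k -> nat) (M : 'M[F]_k) :
    injective r -> (forall i, M i i != 0) ->
    (forall i j, (r i < r j)%N -> M i j = 0) ->
  row_free M.
Proof.
move=> r_inj Mii Mij; apply: inj_row_free => u uM0.
apply/eqP/negPn/negP => /rV0Pn[i0 ui0].
case: (@arg_maxnP _ i0 (fun i => u 0 i != 0) r ui0) => j uj max_j.
have /rowP/(_ j)/eqP := uM0; rewrite !mxE (bigD1 j) //= big1 ?addr0.
  by rewrite mulf_eq0 (negPf uj) (negPf (Mii j)).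
move=> i ne_ij; have [->|ui] := eqVneq (u 0 i) 0; first by rewrite mul0r.
rewrite Mij ?mulr0 // ltn_neqAle (max_j i ui : r i <= r j)%N andbT.
by apply: contraNneq ne_ij => /r_inj->.
Qed.

(* A form of degree b in a + 1 variables has 'C(a + b, a) coefficients, indexed
   by the sorted b-tuples of variables. *)
Lemma rank_prod_linear_forms (F : fieldType) k l a b
    (W : 'I_k -> 'I_a.+1 -> F) (Y : 'I_l -> 'I_b -> 'I_a.+1 -> F)
    (M : 'M[F]_(k, l)) :
    (forall i j, M i j = \prod_(h < b) \sum_(e < a.+1) W i e * Y j h e) ->
  (\rank M <= 'C(a + b, a))%N.
Proof.
move=> defM; pose S := [set t : b.-tuple 'I_a.+1 | sorted leq (map val t)].
have cardS : #|S| = 'C(a + b, a).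
  by rewrite card_sorted_tuples addnC -[RHS]bin_sub ?leq_addr // addKn.
pose srt (f : {ffun 'I_b -> 'I_a.+1}) : b.-tuple 'I_a.+1 :=
  [tuple of sort (fun x y : 'I_a.+1 => x <= y)%N [tuple f h | h < b]].
have srtS f : srt f \in S.
  rewrite inE sorted_map; apply: sort_sorted => x y; exact: leq_total.
(* Once the products are expanded, [M] factors through the monomials: [U] evaluates them at [W i],
   and [V] holds the coefficients of form [j]. *)
pose U := \matrix_(i < k, s < #|S|) \prod_(x <- (enum_val s : b.-tuple _)) W i x.
pose V := \matrix_(s < #|S|, j < l)
  \sum_(f | srt f == enum_val s) \prod_(h < b) Y j h (f h).
suff -> : M = U *m V by rewrite -cardS; apply: mulmx_max_rank.
apply/matrixP => i j; rewrite !mxE defM bigA_distr_bigA /=.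
rewrite (partition_big srt (mem S)) /=; last by move=> f _; apply: srtS.
rewrite big_enum_val /=; apply: eq_bigr => s _.
rewrite !mxE big_distrr /=; apply: eq_bigr => f /eqP <-.
rewrite big_split /=; congr (_ * _).
rewrite (perm_big [tuple f h | h < b]) ?perm_sort //=.
by rewrite big_map big_enum.
Qed.

(* The pair (A, B) gives the polynomial with root set A, and the form taking a
   polynomial w to the product of the values of w on B. *)
Lemma skew_bollobas_card (T : finType) m (K : {set 'I_m})
    (A B : 'I_m -> {set T}) a b :
    skew_on K A B -> (forall i, i \in K -> #|A i| <= a)%N ->
    (forall i, i \in K -> #|B i| <= b)%N ->
  (#|K| <= 'C(a + b, a))%N.
Proof.
move=> [disAB meetAB] leA leB.
(* [y j] is padded with [0], which is not of the form [pt x]. *)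
pose pt (x : T) : rat := (enum_rank x).+1%:R.
pose y (j : 'I_#|K|) h := nth 0 [seq pt x | x <- enum (B (enum_val j))] h.
pose p (i : 'I_#|K|) := \prod_(x <- enum (A (enum_val i))) ('X - (pt x)%:P).
have pt_inj : injective pt.
  by move=> x z /eqP; rewrite eqr_nat eqSS => /eqP/val_inj/enum_rank_inj.
have pE i c : ((p i).[c] == 0) = (c \in [seq pt x | x <- enum (A (enum_val i))]).
  by rewrite -root_prod_XsubC big_map.
have KP (i : 'I_#|K|) : enum_val i \in K by apply: enum_valP.
pose M := \matrix_(i < #|K|, j < #|K|) \prod_(h < b) (p i).[y j h].
have rankM : (\rank M <= 'C(a + b, a))%N.
  (* Since [p i] has degree at most [a], its value at a point is a linear form in [a + 1]
     coefficients. *)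
  apply: (rank_prod_linear_forms (W := fun i e => (p i)`_e)
                                 (Y := fun j h e => y j h ^+ e)) => i j.
  rewrite mxE; apply: eq_bigr => h _; apply: horner_coef_wide.
  by rewrite size_prod_XsubC -cardE ltnS leA.
suff /eqP <- : row_free M by [].
(* Disjointness keeps the diagonal nonzero; when [i] precedes [j], a common element of the [A] of
   [i] and the [B] of [j] yields a zero factor. *)
apply: (triangular_row_free (r := fun i => val (enum_val i))).
- by move=> i j /val_inj/enum_val_inj.
- move=> i; rewrite mxE; apply/prodf_neq0 => h _; rewrite pE.
  have [lt_h|le_h] := ltnP h #|B (enum_val i)|; last first.
    rewrite /y nth_default ?size_map -?cardE //.
    by apply/mapP => -[x _ /esym/eqP]; rewrite pnatr_eq0.
  have: y i h \in [seq pt x | x <- enum (B (enum_val i))].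
    by rewrite mem_nth // size_map -cardE.
  case/mapP => x; rewrite mem_enum => Bx ->; rewrite mem_map // mem_enum.
  by apply/negP => Ax; rewrite (disjointFr (disAB _ (KP i)) Ax) in Bx.
move=> i j lt_ij; have /pred0Pn[x /andP[/= Ax Bx]] := meetAB _ _ (KP i) (KP j) lt_ij.
have lt_h : (index x (enum (B (enum_val j))) < b)%N.
  by apply: leq_trans (leB _ (KP j)); rewrite cardE index_mem mem_enum.
rewrite mxE (bigD1 (Ordinal lt_h)) //= (_ : (p i).[_] = 0) ?mul0r //.
apply/eqP; rewrite pE /y (nth_map x) ?index_mem ?mem_enum // nth_index ?mem_enum //.
by rewrite mem_map // mem_enum.
Qed.

End SkewBollobas.

(** * Upper bound: removing private elements *)

(* Contract each private part Q i to a single point. *)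
Lemma skew_private_card (T : finType) m (K : {set 'I_m})
    (A B Q : 'I_m -> {set T}) a c :
    skew_on K A B -> (forall i, i \in K -> #|A i| <= a) ->
    (forall i, i \in K -> Q i \subset B i) ->
    (forall i, i \in K -> #|B i :\: Q i| <= c) ->
    (forall i j, i \in K -> j \in K -> i != j -> [disjoint Q i & B j]) ->
  #|K| <= 'C(a + c.+1, a).
Proof.
move=> [disAB meetAB] leA sQB leB priv.
pose g x : T + 'I_m :=
  if [pick i in K | x \in Q i] is Some i then inr i else inl x.
have gQ i x : i \in K -> x \in Q i -> g x = inr i.
  move=> Ki Qx; rewrite /g; case: pickP => [j /andP[Kj Qjx] | /(_ i)].
    have [-> //|ne_ij] := eqVneq i j; have := disjointFr (priv _ _ Ki Kj ne_ij) Qx.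
    by rewrite (subsetP (sQB _ Kj)).
  by rewrite Ki Qx.
apply: (@skew_bollobas_card _ _ K (fun i => g @: A i) (fun i => g @: B i)).
- split=> [i Ki | i j Ki Kj lt_ij]; last first.
    have /pred0Pn[x /andP[/= Ax Bx]] := meetAB _ _ Ki Kj lt_ij.
    by apply/pred0Pn; exists (g x); rewrite /= !imset_f.
  apply/pred0P => z /=; apply/negP => /andP[/imsetP[x Ax ->] /imsetP[y By]].
  rewrite /g; case: pickP => [j /andP[Kj Qx] | _];
    case: pickP => [k /andP[Kk Qy] | _] // [].
    (* A common image [inr j] forces [j = i] by privacy, and then [x] lies in both [A i] and
       [B i]. *)
    move=> eq_jk; subst k.
    have [eq_ij|ne_ij] := eqVneq j i; last first.
      by rewrite (disjointFr (priv _ _ Kj Ki ne_ij) Qy) in By.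
    rewrite eq_ij in Qx; have := subsetP (sQB _ Ki) _ Qx.
    by rewrite (disjointFr (disAB _ Ki) Ax).
  by move=> eq_xy; rewrite -eq_xy (disjointFr (disAB _ Ki) Ax) in By.
- by move=> i Ki; apply: leq_trans (leq_imset_card _ _) (leA _ Ki).
move=> i Ki; rewrite -(setID (B i) (Q i)) imsetU.
apply: leq_trans (leq_card_setU _ _) _; rewrite -add1n leq_add //.
  apply: (@leq_trans #|[set inr i : T + 'I_m]|); last by rewrite cards1.
  apply/subset_leq_card/subsetP => _ /imsetP[x /setIP[_ Qx] ->].
  by rewrite (gQ i) // set11.
exact: leq_trans (leq_imset_card _ _) (leB _ Ki).
Qed.

(** Take a subcover minimal under inclusion: if some [D i] had no private element, the cover would
    survive dropping [i]. *)
Lemma minimal_subcover (I T : finType) (J : {set I}) (D : I -> {set T}) :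
  exists2 K : {set I}, K \subset J &
    \bigcup_(i in K) D i = \bigcup_(i in J) D i /\
    forall i, i \in K ->
      exists2 x, x \in D i & forall k, k \in K -> k != i -> x \notin D k.
Proof.
pose P (K : {set I}) := \bigcup_(i in K) D i == \bigcup_(i in J) D i.
have [K /minsetP[/eqP eqK minK] sKJ] := minset_exists (eqxx _ : P J).
exists K => //; split=> // i Ki.
have nsub : ~~ (\bigcup_(k in K) D k \subset \bigcup_(k in K :\ i) D k).
  apply/negP => sub; have /setP/(_ i) : K :\ i = K.
    apply: minK; last exact: subsetDl.
    rewrite /P -eqK eqEsubset sub andbT.
    by apply/bigcupsP => k /setD1P[_ Kk]; apply: bigcup_sup.
  by rewrite !inE eqxx Ki.
case/subsetPn: nsub => x /bigcupP[j Kj Dx] notx.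
have priv k : k \in K -> k != i -> x \notin D k.
  move=> Kk ne_ki; apply: contra notx => Dkx.
  by apply/bigcupP; exists k; rewrite ?in_setD1 ?ne_ki.
exists x => //; have [<- //|ne_ji] := eqVneq j i.
by rewrite (negPf (priv j Kj ne_ji)) in Dx.
Qed.

(** Induction on [c] with [J] and [Q] varying: [Q] records the elements removed so far. The strict
    inequality stands for the [- 1] of the final bound. *)
Lemma card_union_bound (T : finType) m (A B : 'I_m -> {set T}) a c :
  forall (J : {set 'I_m}) (Q : 'I_m -> {set T}),
    skew_on J A B -> (forall i, i \in J -> #|A i| <= a) ->
    (forall i, i \in J -> Q i \subset B i) ->
    (forall i, i \in J -> #|B i :\: Q i| <= c) ->
    (forall i j, i \in J -> j \in J -> i != j -> [disjoint Q i & B j]) ->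
  #|\bigcup_(i in J) (B i :\: Q i)| < 'C(a + c + 1, a + 1).
Proof.
elim: c => [|c IHc] J Q skewAB leA sQB leB priv.
  rewrite big1 ?cards0 ?addn0 ?binn // => i Ji.
  by apply/eqP; rewrite -cards_eq0 -leqn0 leB.
have [K sKJ [<- privK]] := minimal_subcover J (fun i => B i :\: Q i).
have KJ i : i \in K -> i \in J by apply: (subsetP sKJ).
(* The element in [S i] is private with respect to the whole sets [B k], not only their remainders,
   because [Q k] is disjoint from [B i]. *)
have /fin_all_exists[S SP] i : exists S : {set T}, i \in K ->
    [/\ #|S| = 1, S \subset B i :\: Q i &
        forall k, k \in K -> k != i -> [disjoint S & B k]].
  have [Ki|_] := boolP (i \in K); last by exists set0.
  have [x Dx privx] := privK i Ki; exists [set x] => _.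
  split=> [||k Kk ne_ki]; rewrite ?cards1 ?sub1set // disjoints1.
  apply: contra (privx k Kk ne_ki) => Bkx; rewrite inE Bkx andbT.
  have := priv k i (KJ _ Kk) (KJ _ Ki) ne_ki.
  by case/setDP: Dx => Bix _ disQ; rewrite (disjointFl disQ Bix).
pose Q' i := Q i :|: S i.
have skewK : skew_on K A B.
  by case: skewAB => dis meet; split=> [i|i j] *; [apply: dis|apply: meet]; auto.
have leAK i : i \in K -> #|A i| <= a by auto.
have sQ'B i : i \in K -> Q' i \subset B i.
  move=> Ki; rewrite subUset sQB ?KJ //=; have [_ sSD _] := SP i Ki.
  exact: subset_trans sSD (subsetDl _ _).
have leBK i : i \in K -> #|B i :\: Q' i| <= c.
  move=> Ki; have [S1 sSD _] := SP i Ki; rewrite -ltnS -setDDl.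
  apply: leq_trans (leB i (KJ _ Ki)).
  by rewrite cardsD (setIidPr sSD) S1; have := subset_leq_card sSD; lia.
have privQ' i j : i \in K -> j \in K -> i != j -> [disjoint Q' i & B j].
  move=> Ki Kj ne_ij; have [_ _ disS] := SP i Ki.
  rewrite -setI_eq0 setIUl setU_eq0 !setI_eq0 disS 1?eq_sym // andbT.
  by apply: priv; auto.
have le_K : #|K| <= 'C(a + c.+1, a) by apply: skew_private_card skewK leAK sQ'B leBK privQ'.
have ltU := IHc K Q' skewK leAK sQ'B leBK privQ'.
have leS : #|\bigcup_(i in K) S i| <= #|K|.
  apply: leq_trans (leq_card_bigcup _ _) _.
  by rewrite -sum1_card leq_sum // => i Ki; have [->] := SP i Ki.
have sub : \bigcup_(i in K) (B i :\: Q i) \subset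
    \bigcup_(i in K) (B i :\: Q' i) :|: \bigcup_(i in K) S i.
  apply/bigcupsP => i Ki; apply/subsetP => x Dx; rewrite inE.
  have [Sx|nSx] := boolP (x \in S i).
    by apply/orP; right; apply/bigcupP; exists i.
  apply/orP; left; apply/bigcupP; exists i => //.
  by move: Dx; rewrite !inE (negPf nSx) orbF.
(* Pascal's rule: the first term bounds the new remainders, the second the points just removed. *)
have -> : 'C(a + c.+1 + 1, a + 1) = 'C(a + c + 1, a + 1) + 'C(a + c.+1, a).
  by rewrite !addn1 !addnS binS.
rewrite (leq_trans _ (leq_add ltU le_K)) // addSn ltnS.
apply: leq_trans (subset_leq_card sub) _.
by apply: leq_trans (leq_card_setU _ _) _; rewrite leq_add2l.
Qed.

(** * Lower bound: gluing two systems *)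

Section LowerBound.

Variables (T1 T2 : finType) (m1 m2 : nat).
Variables (A1 B1 : 'I_m1 -> {set T1}) (A2 B2 : 'I_m2 -> {set T2}).

Let in1 (x : T1) : option (T1 + T2) := Some (inl x).
Let in2 (x : T2) : option (T1 + T2) := Some (inr x).

Definition glueA (i : 'I_(m1 + m2)) : {set option (T1 + T2)} :=
  match split i with
  | inl j => None |: in1 @: A1 j
  | inr j => in2 @: A2 j
  end.

Definition glueB (i : 'I_(m1 + m2)) : {set option (T1 + T2)} :=
  match split i with
  | inl j => in1 @: B1 j
  | inr j => None |: in2 @: B2 j
  end.

Let in1_inj : injective in1. Proof. by move=> x y []. Qed.
Let in2_inj : injective in2. Proof. by move=> x y []. Qed.
Let NoneF1 (S : {set T1}) : None \notin in1 @: S. Proof. by apply/imsetP => -[]. Qed.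
Let NoneF2 (S : {set T2}) : None \notin in2 @: S. Proof. by apply/imsetP => -[]. Qed.

(** Across the systems, [i] comes from the first and [j] from the second, so [glueA i] and [glueB j]
    share the new point [None]. *)
Lemma glue_skew :
  skew_on setT A1 B1 -> skew_on setT A2 B2 -> skew_on setT glueA glueB.
Proof.
move=> [dis1 meet1] [dis2 meet2]; split=> [i _|i j _ _ lt_ij].
  rewrite /glueA /glueB; case: split => k.
    rewrite -setI_eq0 setIUl setU_eq0 !setI_eq0 disjoints1 NoneF1.
    by rewrite imset_disjoint ?dis1 //; apply: in2W.
  rewrite disjoint_sym -setI_eq0 setIUl setU_eq0 !setI_eq0 disjoints1 NoneF2.
  by rewrite disjoint_sym imset_disjoint ?dis2 //; apply: in2W.
rewrite /glueA /glueB; move: lt_ij.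
case: (splitP i) => k ->; case: (splitP j) => l -> lt_kl.
- have /pred0Pn[x /andP[/= Ax Bx]] := meet1 k l (in_setT _) (in_setT _) lt_kl.
  by apply/pred0Pn; exists (in1 x); rewrite /= inE !imset_f ?orbT.
- by apply/pred0Pn; exists None; rewrite /= !inE eqxx.
- by have := ltn_ord l; lia.
rewrite ltn_add2l in lt_kl.
have /pred0Pn[x /andP[/= Ax Bx]] := meet2 k l (in_setT _) (in_setT _) lt_kl.
by apply/pred0Pn; exists (in2 x); rewrite /= inE !imset_f ?orbT.
Qed.

Lemma card_glueA a :
    (forall i, #|A1 i| <= a) -> (forall i, #|A2 i| <= a.+1) ->
  forall i, #|glueA i| <= a.+1.
Proof.
move=> le1 le2 i; rewrite /glueA; case: split => k.
  by rewrite cardsU1 NoneF1 card_imset // ltnS.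
by rewrite card_imset.
Qed.

Lemma card_glueB b :
    (forall i, #|B1 i| <= b.+1) -> (forall i, #|B2 i| <= b) ->
  forall i, #|glueB i| <= b.+1.
Proof.
move=> le1 le2 i; rewrite /glueB; case: split => k.
  by rewrite card_imset.
by rewrite cardsU1 NoneF2 card_imset // ltnS.
Qed.

Lemma card_glue_union : 0 < m2 ->
  #|\bigcup_i glueB i| = (#|\bigcup_i B1 i| + #|\bigcup_i B2 i|).+1.
Proof.
move=> m2_gt0.
have -> : \bigcup_i glueB i =
    None |: (in1 @: (\bigcup_i B1 i) :|: in2 @: (\bigcup_i B2 i)).
  apply/setP => z; rewrite !inE; apply/bigcupP/idP => [[i _]|].
    rewrite /glueB; case: split => k; rewrite ?inE.
      case/imsetP => x Bx ->; rewrite [_ \in in1 @: _]imset_f ?orbT //.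
      by apply/bigcupP; exists k.
    case/orP => [-> // | /imsetP[x Bx ->]].
    by rewrite [_ \in in2 @: _]imset_f ?orbT //; apply/bigcupP; exists k.
  case/or3P => [/eqP-> | /imsetP[x /bigcupP[k _ Bx] ->] | /imsetP[x /bigcupP[k _ Bx] ->]].
  (* Every set of the second system receives the new point, so its first index serves. *)
  - exists (rshift m1 (Ordinal m2_gt0)) => //.
    by rewrite /glueB (unsplitK (inr _)) setU11.
  - by exists (lshift m2 k) => //; rewrite /glueB (unsplitK (inl _)) imset_f.
  by exists (rshift m1 k) => //; rewrite /glueB (unsplitK (inr _)) inE imset_f ?orbT.
rewrite cardsU1 inE (negPf (NoneF1 _)) (negPf (NoneF2 _)) add1n cardsU.
rewrite !card_imset // (_ : _ :&: _ = set0) ?cards0 ?subn0 //.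
by apply/setP => z; rewrite !inE; apply/andP => -[/imsetP[x _ ->] /imsetP[]].
Qed.

End LowerBound.

(** Systems are nonempty here, so that the point added by gluing lies in some [B]. *)
Definition skew_union (a b s : nat) : Prop :=
  exists (T : finType) (m : nat) (A B : 'I_m -> {set T}),
    [/\ 0 < m, skew_on setT A B, forall i, #|A i| <= a,
        forall i, #|B i| <= b & #|\bigcup_i B i| = s].

(** Serves both base cases: the target value is [b] for [a = 0] and [0] for [b = 0]. *)
Lemma skew_union_single a b : skew_union a b b.
Proof.
exists 'I_b, 1, (fun=> set0), (fun=> setT).
split=> // [|i|i|]; rewrite ?cards0 ?cardsT ?card_ord //; last first.
  by rewrite big_ord1 cardsT card_ord.
by split=> [i _|i j _ _]; rewrite ?ord1 // -setI_eq0 set0I.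
Qed.

Lemma skew_union_glue a b s t :
  skew_union a b.+1 s -> skew_union a.+1 b t -> skew_union a.+1 b.+1 (s + t).+1.
Proof.
move=> [T1 [m1 [A1 [B1 [m1_gt0 sk1 leA1 leB1 <-]]]]].
move=> [T2 [m2 [A2 [B2 [m2_gt0 sk2 leA2 leB2 <-]]]]].
exists (option (T1 + T2)), (m1 + m2), (glueA A1 A2), (glueB B1 B2); split.
- by rewrite addn_gt0 m1_gt0.
- exact: glue_skew.
- exact: card_glueA.
- exact: card_glueB.
exact: card_glue_union.
Qed.

Lemma skew_union_binomial a b : skew_union a b ('C(a + b + 1, a + 1) - 1).
Proof.
elim: a b => [|a IHa] b.
  by rewrite bin1 addnK; apply: skew_union_single.
elim: b => [|b IHb].
  by rewrite addn0 binn; apply: skew_union_single.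
have := skew_union_glue (IHa b.+1) IHb; congr skew_union.
(* Positivity makes the truncated subtractions exact; the new point offsets one of the two [- 1]
   terms. *)
have C1 : 0 < 'C(a + b.+1 + 1, a + 1) by rewrite bin_gt0; lia.
have C2 : 0 < 'C(a.+1 + b + 1, a.+1 + 1) by rewrite bin_gt0; lia.
have -> : 'C(a.+1 + b.+1 + 1, a.+1 + 1) =
    'C(a.+1 + b + 1, a.+1 + 1) + 'C(a + b.+1 + 1, a + 1).
  by rewrite !addn1 !addnS !addSn binS.
by move: C1 C2; lia.
Qed.

Lemma skew_union_attained a b s : skew_union a b s -> S2_attained a b s.
Proof.
move=> [T [m [A [B [_ [dis meet] leA leB <-]]]]].
(* [option T] keeps the ground set nonempty. *)
pose g (x : T) := enum_rank (Some x).
have g_inj : injective g by move=> x y /enum_rank_inj[].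
exists #|{: option T}|, m, (fun i => g @: A i), (fun i => g @: B i).
split=> [||i|i|]; rewrite ?card_option ?card_imset //.
  split=> [i|i j lt_ij].
    by apply/eqP; rewrite setI_eq0 imset_disjoint ?dis //; apply: in2W.
  apply/eqP; rewrite setI_eq0 imset_disjoint ?meet //; exact: in2W.
by rewrite -(big_morph _ (imsetU g) (imset0 g)) card_imset.
Qed.

Theorem theorem1p4 (a b : nat) : is_S2 a b ('C(a + b + 1, a + 1) - 1).
Proof.
split; first exact/skew_union_attained/skew_union_binomial.
move=> t [n [m [A [B [_ [dis meet] leA leB <-]]]]].
have skewAB : skew_on setT A B.
  split=> [i _|i j _ _ lt_ij]; rewrite -setI_eq0; first exact/eqP.
  exact/eqP/meet.
(* Nothing has been removed at the start, so [Q] is empty and [c] is [b]. *)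
have := @card_union_bound _ _ A B a b setT (fun=> set0) skewAB.
have -> : \bigcup_(i in setT) (B i :\: set0) = \bigcup_i B i.
  by apply: eq_big => i; rewrite ?inE ?setD0.
move=> bound; rewrite -ltnS subn1 prednK ?bin_gt0; last by lia.
apply: bound => // [i _|i _|i j _ _ _].
- exact: sub0set.
- by rewrite setD0.
by rewrite -setI_eq0 set0I.
Qed.
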